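(* Assume the Continuum Hypothesis. Let $X$ be a productively quasi-Lindelöf space such that $\ell(X^\omega)\leq\mathfrak{c}$. Then $X$ is powerfully quasi-Lindelöf.
   Context: The Continuum Hypothesis is the statement $2^{\aleph_0}=\aleph_1$, and $\mathfrak{c}=2^{\aleph_0}$. A space is an arbitrary topological space unless separation axioms are stated. A space is quasi-Lindelöf if every open cover of it has a countable subcover (no separation axioms). A space is Lindelöf if it is regular (which includes $\mathsf{T}_1$) and quasi-Lindelöf. A space $X$ is productively quasi-Lindelöf if $X\times Y$ is quasi-Lindelöf for every Lindelöf space $Y$. A space $X$ is powerfully quasi-Lindelöf if $X^\omega$ (with the product topology) is quasi-Lindelöf. The Lindelöf number $\ell(Z)$ of a space $Z$ is the least cardinal $\kappa$ such that every open cover of $Z$ has a subcover of size at most $\kappa$. *)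

(* Defs.v *)
From HB Require Import structures.
From mathcomp Require Import all_boot all_order all_classical.
From mathcomp Require Import topology.
Set Implicit Arguments.
Unset Strict Implicit.
Unset Printing Implicit Defensive.
Local Open Scope classical_set_scope.
Local Open Scope card_scope.

(* A cardinal is represented by any set having that cardinality. *)
Definition continuum : set (nat -> bool) := setT.

(* aleph_1 is the least uncountable cardinal *)
Definition is_aleph1 (T : Type) (A : set T) : Prop :=
  ~ countable A /\
  forall (U : Type) (B : set U), ~ countable B -> A #<= B.

Definition continuum_hypothesis : Prop := is_aleph1 continuum.

Definition open_cover (X : topologicalType) (C : set (set X)) : Prop :=
  C `<=` open /\ cover C id = setT.

Definition quasi_lindelof (X : topologicalType) : Prop :=
  forall C : set (set X), open_cover C ->
    exists D, [/\ D `<=` C, countable D & cover D id = setT].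

(* [regular_space] does not include the T1 axiom. *)
Definition lindelof (X : topologicalType) : Prop :=
  [/\ regular_space X, accessible_space X & quasi_lindelof X].

Definition productively_quasi_lindelof (X : topologicalType) : Prop :=
  forall Y : topologicalType, lindelof Y -> quasi_lindelof (X * Y)%type.

(* [{ptws nat -> X}] is X^omega with the product topology. *)
Definition powerfully_quasi_lindelof (X : topologicalType) : Prop :=
  quasi_lindelof {ptws nat -> X}.

Definition subcovers_of_size_le (Z : topologicalType) (T : Type)
    (kappa : set T) : Prop :=
  forall C : set (set Z), open_cover C ->
    exists D, [/\ D `<=` C, D #<= kappa & cover D id = setT].

Definition is_lindelof_number (Z : topologicalType) (T : Type)
    (kappa : set T) : Prop :=
  subcovers_of_size_le Z kappa /\
  forall (U : Type) (lambda : set U),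
    subcovers_of_size_le Z lambda -> kappa #<= lambda.

(* Main.v *)
Require Import Defs.
From HB Require Import structures.
From mathcomp Require Import all_boot all_order all_classical.
From mathcomp Require Import topology.
From mathcomp Require Import finmap.
From mathcomp Require wochoice.
Local Open Scope classical_set_scope.
Local Open Scope card_scope.

(** The proof has three stages.

    Reduction to a Cantor cube.  A cover of X^omega can be refined to at most
    continuum many basic boxes, so only continuum many open sets U t of X
    matter, and they may be indexed by t : nat -> bool.  A point x of X is
    replaced by the compact family of all sets y of indices t with x outside
    U t; the union [noncovers U] of these families is a downward closed subset
    N of the Cantor cube 2^(nat -> bool).  Its complement consists of the y
    such that the U t with t in y cover X.  The passage from X to N is an upper
    semicontinuous compact-valued map, so N inherits the covering properties
    of X, and it lives in a zero-dimensional compact Hausdorff cube although no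
    separation is assumed for X.  The box of the z in X^omega with z i in U t,
    for finitely many pairs (i, t), becomes the clopen box of the y in N^omega
    with t not in y i.

    Alster's theorem under CH (countable_subcover_of_codes).  A closed G_delta
    set of the cube is the complement of a countable union of basic clopen
    sets, hence is coded by a countable set of finite conditions, and there are
    only aleph_1 codes.  The claim is that if every compact subset of N lies in
    a member of a family GG of closed G_delta sets, then countably many members
    of GG cover N.  The hypothesis on X enters through Michael's technique
    (Lindelof_separation): if L is a Lindelof subset of the complement of N,
    then N is covered by countably many closed G_delta sets missing L.
    Otherwise one chooses aleph_1 points y_a of N that escape from more and
    more of the closed G_delta sets missing L; making them isolated turns
    L together with the y_a into a Lindelof space whose product with X is not
    Lindelof.  Separation is used twice.  First, for a countable set d of
    coordinates, the set [outside d] of the points whose restriction to d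
    already lies outside N is Lindelof, and separation makes it a G_delta.
    Enumerate GG in type omega_1 and cut the t-th member down to
    [piece t], its part that is not in [outside d] for d the set of
    predecessors of t.  Each compact subset of N lies in a piece, and pieces
    are sigma-compact.  A Baire category argument (coverable_closed) shows that
    a compact set contained in the union of all pieces is covered by countably
    many of them.  Therefore the complement L of the union of all pieces is
    Lindelof, and a second use of separation gives countably many compact sets
    covering N and contained in the union of all pieces, so countably many
    pieces cover N.

    Powers (countable_power_subcover).  If no countable set of boxes covers
    N^omega, Alster's theorem yields compact sets K_0, K_1, ... contained in N
    such that for no n are there closed G_delta sets G_i containing K_i, i < n,
    with the part of N^omega over G_0 x ... x G_(n-1) covered by countably many
    boxes.  But the product of all K_i is compact, so finitely many boxes cover
    it, and these boxes depend on finitely many coordinates: a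
    contradiction. *)

Set Implicit Arguments.
Unset Strict Implicit.
Unset Printing Implicit Defensive.

(** * Countable sets and choice *)

Lemma choice_in (A B : Type) (b0 : B) (D : A -> Prop) (R : A -> B -> Prop) :
  (forall x, D x -> exists y, R x y) ->
  exists f : A -> B, forall x, D x -> R x (f x).
Proof.
move=> DR; have [x|f fP] := @boolp.choice A B (fun x y => D x -> R x y).
  by have [/DR[y]|nD] := pselect (D x); [exists y|exists b0].
by exists f.
Qed.

Lemma countable_seq (T : choiceType) (s : seq T) : countable [set` s].
Proof.
rewrite (_ : [set` s] = [set` [fset i | i in s]%fset]); first exact: countable_fset.
by rewrite predeqE => i; split=> /=; rewrite inE.
Qed.

Lemma countableU (T : Type) (A B : set T) :
  countable A -> countable B -> countable (A `|` B).
Proof.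
by move=> cA cB; rewrite -bigcup2E; apply: bigcup_countable => // -[|[|i]] _.
Qed.

Lemma countable_image (S T : Type) (f : S -> T) (A : set S) :
  countable A -> countable (f @` A).
Proof. by apply: sub_countable; exact: card_image_le. Qed.

(** * Boxes in products and conditions in Cantor cubes *)

Lemma ptws_nbhs_box (I : choiceType) (K : topologicalType)
    (z : {ptws I -> K}) (A : set {ptws I -> K}) : nbhs z A ->
  exists s : seq (I * set K),
    (forall io, io \in s -> open io.2 /\ io.2 (z io.1)) /\
    forall z' : I -> K, (forall io, io \in s -> io.2 (z' io.1)) -> A z'.
Proof.
move=> [] P [] [] Q QfinP <- [] V JV Vz PA.
have [L Lsub LV] := QfinP _ JV.
suff [s [s1 s2]] : exists s : seq (I * set K),
    (forall io, io \in s -> open io.2 /\ io.2 (z io.1)) /\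
    forall z' : I -> K, (forall io, io \in s -> io.2 (z' io.1)) -> V z'.
  by exists s; split=> // z' /s2 Vz'; apply: PA; exists V.
have {}Lsub : forall M, M \in enum_fset L -> exists io : I * set K,
    [/\ open io.2, io.2 (z io.1) & forall z' : I -> K, io.2 (z' io.1) -> M z'].
  move=> M LM; have : M z by move: Vz; rewrite -LV; apply.
  by have /set_mem [i _ [/= N oN <-]] := Lsub _ LM => Nz; exists (i, N).
have {}LV z' : (forall M, M \in enum_fset L -> M z') -> V z'.
  by move=> h; rewrite -LV => M /= LM; apply: h.
move: (enum_fset L) V Lsub LV {JV Vz PA} => {}L V.
elim: L V => [|M L IH] V Lsub LV.
  by exists [::]; split=> // z' _; exact: LV.
have [||s [s1 s2]] := IH [set z' | forall M', M' \in L -> M' z'].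
- by move=> M' LM'; apply: Lsub; rewrite inE LM' orbT.
- by [].
have [io [o1 o2 o3]] := Lsub M (mem_head _ _).
exists (io :: s); split=> [jo|z' h].
  by rewrite inE => /predU1P[->//|/s1].
apply: LV => M'; rewrite inE => /predU1P[->|LM'].
  by apply: o3; apply: h; rewrite mem_head.
by apply: s2 => // jo sjo; apply: h; rewrite inE sjo orbT.
Qed.

Lemma ptws_open_box (I : choiceType) (K : topologicalType)
    (s : seq (I * set K)) : (forall io, io \in s -> open io.2) ->
  open ([set z | forall io, io \in s -> io.2 (z io.1)] : set {ptws I -> K}).
Proof.
elim: s => [|[i A] s IH] os.
  rewrite (_ : [set z | _] = setT); first exact: openT.
  by rewrite predeqE => z; split.
rewrite (_ : [set z | _] = (fun z : {ptws I -> K} => z i) @^-1` A `&`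
   [set z | forall io, io \in s -> io.2 (z io.1)]); last first.
  rewrite predeqE => z; split=> [h|[h1 h2]].
    split; first exact: (h (i, A) (mem_head _ _)).
    by move=> io sio; apply: h; rewrite inE sio orbT.
  by move=> io; rewrite inE => /predU1P[->//|]; exact: h2.
apply: openI; last by apply: IH => io sio; apply: os; rewrite inE sio orbT.
apply: open_comp; last exact: (os (i, A) (mem_head _ _)).
by move=> z _; exact: (@proj_continuous I (fun=> K) i z).
Qed.

(** The alias carries the pointed structure that the equivalence between
    compactness and the finite subcover property requires. *)
Definition cube (I : Type) : Type := {ptws I -> bool}.
HB.instance Definition _ (I : Type) := Pointed.on (cube I).
HB.instance Definition _ (I : Type) := Nbhs.on (cube I).
HB.instance Definition _ (I : Type) := Topological.on (cube I).
HB.instance Definition _ (I : Type) := Uniform.on (cube I).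

Section Cantor.
Variable I : choiceType.
Implicit Types (p q : seq (I * bool)) (z : I -> bool) (P Q : set (seq (I * bool))).

(** A finite list of prescribed values is called a condition. *)
Definition cyl p : set (I -> bool) := [set z | all (fun ib => z ib.1 == ib.2) p].

Definition cylU P : set (I -> bool) := \bigcup_(p in P) cyl p.

(** Closed subsets of the cube are described by conditions only, so that
    everything except compactness is combinatorial. *)
Definition cube_closed (F : set (I -> bool)) :=
  forall z, ~ F z -> exists2 p, cyl p z & cyl p `<=` ~` F.

Definition supported (d : set I) p := forall ib, ib \in p -> d ib.1.

Lemma cylP p z : cyl p z <-> forall ib, ib \in p -> z ib.1 = ib.2.
Proof.
split; first by move=> /allP h ib /h /eqP.
by move=> h; apply/allP => ib /h ->.
Qed.

Lemma cyl_cat p q : cyl (p ++ q) = cyl p `&` cyl q.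
Proof.
rewrite predeqE => z; rewrite /cyl /= all_cat.
by split=> [/andP[]//|[h1 h2]]; apply/andP.
Qed.

Lemma supported_cat d p q : supported d p -> supported d q -> supported d (p ++ q).
Proof. by move=> h1 h2 ib; rewrite mem_cat => /orP[/h1|/h2]. Qed.

Lemma eq_cyl (d : set I) p z z' : supported d p ->
  (forall i, d i -> z i = z' i) -> cyl p z -> cyl p z'.
Proof. by move=> sp e /cylP h; apply/cylP => ib pib; rewrite -e ?h//; exact: sp. Qed.

Lemma open_cyl p : open (cyl p : set (cube I)).
Proof.
have := @ptws_open_box I bool [seq (ib.1, [set ib.2]) | ib <- p].
rewrite (_ : [set z | _] = cyl p); first apply.
  by move=> io /mapP[ib _ ->]; exact: discrete_open.
rewrite predeqE => z; split=> [h|/cylP h io /mapP[ib /h pib ->//]].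
by apply/cylP => ib pib; exact: (h (ib.1, [set ib.2]) (map_f _ pib)).
Qed.

Lemma nbhs_cyl (z : cube I) (A : set (cube I)) :
  nbhs z A -> exists2 p, cyl p z & cyl p `<=` A.
Proof.
move=> /ptws_nbhs_box [s [s1 s2]].
exists [seq (io.1, z io.1) | io <- s]; first by apply/cylP => ib /mapP[io _ ->].
move=> z' /cylP h; apply: s2 => io sio.
by rewrite (h _ (map_f _ sio)); have [_] := s1 io sio.
Qed.

Lemma cube_closed_cylU P : cube_closed (~` cylU P).
Proof. by move=> z /contrapT [p Pp pz]; exists p => // z' pz'; apply; exists p. Qed.

Lemma cube_closedI F G : cube_closed F -> cube_closed G -> cube_closed (F `&` G).
Proof.
move=> cF cG z; have [Fz|/cF[p pz pF]] := pselect (F z); last first.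
  by move=> _; exists p => // z' /pF h [].
have [Gz nFG|/cG[p pz pF]] := pselect (G z); first by case: nFG.
by move=> _; exists p => // z' /pF h [].
Qed.

Lemma cube_closed_cyl p : cube_closed (cyl p).
Proof.
move=> z /negP /allPn[ib pib /eqP nz].
exists [:: (ib.1, z ib.1)]; first by apply/cylP => jb; rewrite inE => /eqP ->.
move=> z' /cylP /(_ _ (mem_head _ _)) /= e /cylP /(_ _ pib) e'.
by apply: nz; rewrite -e'; exact: esym.
Qed.

(** Tychonoff's theorem, after completing the cover of F to a cover of the cube
    by the conditions that exclude F. *)
Lemma cube_closed_subcover F P : cube_closed F -> F `<=` cylU P ->
  exists s : seq (seq (I * bool)), (forall p, p \in s -> P p) /\
    forall z, F z -> exists2 p, p \in s & cyl p z.
Proof.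
move=> cF FP.
have cT : @cover_compact (cube I) setT.
  have <- : @compact (cube I) = @cover_compact (cube I).
    exact: compact_cover.
  have := @tychonoff I (fun=> bool) (fun=> setT) (fun=> bool_compact).
  by congr compact; rewrite predeqE => z; split.
move: cT => /(_ (seq (I * bool)) [set p | P p \/ cyl p `<=` ~` F] cyl).
case=> [p _|z _|s sP sc]; first exact: open_cyl.
  have [/FP[p Pp pz]|/cF[p pz pF]] := pselect (F z); first by exists p => //; left.
  by exists p => //; right.
exists [seq p <- enum_fset s | `[< P p >]]; split=> [p|z Fz].
  by rewrite mem_filter => /andP[/asboolP].
have [//|p /= sp pz] := sc z; exists p => //.
rewrite mem_filter; apply/andP; split=> //; apply/asboolP.
by have /set_mem [//|/(_ _ pz)] := sP p sp.
Qed.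

(** Baire category theorem in a closed set F, in a version where the search is
    confined to the conditions satisfying C: it produces points that are
    generic only with respect to a prescribed set of coordinates. *)
Lemma cube_closed_baire (J : Type) (D : set J) (R : J -> set (seq (I * bool)))
    F (C : seq (I * bool) -> Prop) p0 : countable D -> cube_closed F ->
  (forall j p, D j -> C p -> F `&` cyl p !=set0 ->
     exists r, [/\ R j r, C (p ++ r) & F `&` cyl (p ++ r) !=set0]) ->
  C p0 -> F `&` cyl p0 !=set0 ->
  exists z, [/\ F z, cyl p0 z & forall j, D j -> cylU (R j) z].
Proof.
move=> /countable_injP[e einj] cF step C0 m0.
have [[n p] /= [Cp mp]|f fP] := choice_in [::]
    (D := fun np => C np.2 /\ F `&` cyl np.2 !=set0)
    (R := fun np r => [/\ forall j, D j -> e j = np.1 -> R j r,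
       C (np.2 ++ r) & F `&` cyl (np.2 ++ r) !=set0]).
  have [[j [Dj ejn]]|nj] :=
    pselect (exists j, D j /\ e j = n); last first.
    by exists [::]; rewrite cats0; split=> // j Dj ejn; case: nj; exists j.
  have [r [Rr Cr mr]] := step j p Dj Cp mp; exists r; split=> // j' Dj' ej'n.
  by rewrite (_ : j' = j) //; apply: einj; rewrite ?ejn//; exact/mem_set.
(* q n decides membership in the open sets of index j with e j < n *)
pose q := fix q n := if n is n.+1 then q n ++ f (n, q n) else p0.
have qP n : C (q n) /\ F `&` cyl (q n) !=set0.
  by elim: n => [//|n qn]; have [] := fP (n, q n) qn.
have qS n m z : (n <= m)%N -> cyl (q m) z -> cyl (q n) z.
  move=> /subnK <-; elim: (m - n)%N => [//|k IH].
  by rewrite addSn /= cyl_cat => -[/IH].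
have [z zP] : exists z, forall n, F z /\ cyl (q n) z.
  apply: contrapT => /forallNP no.
  have FP : F `<=` cylU [set p | exists n, cyl p `<=` ~` cyl (q n)].
    move=> z Fz; have [n nz] : exists n, ~ cyl (q n) z.
      by apply/existsNP => h; apply: (no z) => n.
    by have [p pz pq] := cube_closed_cyl nz; exists p => //; exists n.
  have [s [sP sF]] := cube_closed_subcover cF FP.
  have [N NP] : exists N, forall p, p \in s -> cyl p `<=` ~` cyl (q N).
    elim: s sP {sF} => [|p s IH] sP; first by exists 0%N.
    have [|N NP] := IH; first by move=> r rs; apply: sP; rewrite inE rs orbT.
    have [n nP] := sP p (mem_head _ _); exists (maxn n N) => r.
    rewrite inE => /predU1P[->|/NP h] z rz qz.
      by apply: (nP z rz); apply: qS qz; rewrite leq_maxl.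
    by apply: (h z rz); apply: qS qz; rewrite leq_maxr.
  have [_ [z [Fz qz]]] := qP N.
  by have [p ps pz] := sF z Fz; exact: (NP p ps z pz qz).
exists z; split; [by have [] := zP 0%N|by have [] := zP 0%N|move=> j Dj].
have [_] := zP (e j).+1; rewrite /= cyl_cat => -[_ fz].
by exists (f (e j, q (e j))) => //; have [h _ _] := fP (e j, q (e j)) (qP _); exact: h.
Qed.

(** The coordinates on which membership in [cylU P] depends. *)
Definition csupp P : set I := [set i | exists2 p, P p & exists2 ib, ib \in p & ib.1 = i].

Lemma countable_supported (d : set I) : countable d ->
  countable [set p | supported d p].
Proof.
move=> /countable_injP[f finj]; apply/countable_injP.
exists (fun p => choice.pickle [seq (f ib.1, ib.2) | ib <- p]) => p q.
move=> /set_mem sp /set_mem sq /(pcan_inj choice.pickleK).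
elim: p q sp sq => [|a p IH] [|b q]//= sp sq [fab ab] pq.
congr cons; last first.
  by apply: IH pq => ib pib; [apply: sp|apply: sq]; rewrite inE pib orbT.
case: a b ab fab sp sq => [i x] [j y] /= -> fij sp sq; congr pair.
by apply: finj => //; apply/mem_set; [apply: (sp (i, y))|apply: (sq (j, y))]; rewrite mem_head.
Qed.

Lemma countable_csupp P : countable P -> countable (csupp P).
Proof.
move=> cP; rewrite (_ : csupp P = \bigcup_(p in P) [set i | i \in map fst p]).
  apply: bigcup_countable => // p _.
  exact: (countable_seq (map fst p)).
rewrite predeqE => i; split=> [[p Pp [ib pib <-]]|[p Pp /mapP[ib pib ->]]].
  by exists p => //=; exact: map_f.
by exists p => //; exists ib.
Qed.

(** This is the Lindelof property, as every open cover can be refined to a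
    cover by basic clopen sets. *)
Definition cylLindelof (L : set (I -> bool)) := forall P, L `<=` cylU P ->
  exists Q, [/\ Q `<=` P, countable Q & L `<=` cylU Q].

Definition saturated (d : set I) (L : set (I -> bool)) :=
  forall z z', L z -> (forall i, d i -> z i = z' i) -> L z'.

(** Such a set is the product of a subset of a metrizable cube 2^d and a
    compact cube.  For y in L the fiber of y is compact, so a neighbourhood of
    it given by a condition supported in d is covered by finitely many members
    of the cover; there are only countably many conditions supported in d. *)
Lemma saturated_Lindelof d L : countable d -> saturated d L -> cylLindelof L.
Proof.
move=> cd sL P LP.
pose B := [set r | supported d r /\ exists s : seq (seq (I * bool)),
   (forall p, p \in s -> P p) /\ cyl r `<=` cylU [set` s]].
have [f fP] := @choice_in _ _ [::] B (fun r s => (forall p, p \in s -> P p) /\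
    cyl r `<=` cylU [set` s]) (fun r Br => Br.2).
exists (\bigcup_(r in B) [set` f r]); split.
- by move=> p [r /fP[fr _] /= /fr].
- apply: bigcup_countable => [|r _].
    by apply: sub_countable (countable_supported cd); apply: subset_card_le => r [].
  exact: countable_seq.
move=> y Ly.
pose F := [set z | forall i, d i -> y i = z i].
have cF : cube_closed F.
  move=> z /existsNP[i /not_implyP[di nyz]].
  exists [:: (i, z i)]; first by apply/cylP => jb; rewrite inE => /eqP ->.
  move=> z' /cylP /(_ _ (mem_head _ _)) /= e /(_ i di) h; apply: nyz.
  by rewrite h e.
have [s [sP sF]] := cube_closed_subcover cF (fun z Fz => LP z (sL y z Ly Fz)).
have sC : ~` cylU [set` s] `<=`
    cylU [set r | exists i, d i /\ r = [:: (i, ~~ y i)]].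
  move=> z nz; have : ~ F z by move=> Fz; apply: nz; have [p sp pz] := sF z Fz; exists p.
  move=> /existsNP[i /not_implyP[di nyz]].
  exists [:: (i, ~~ y i)]; first by exists i.
  apply/cylP => ib; rewrite inE => /eqP -> /=.
  by case: (z i) (y i) nyz => -[].
have [t [tP tF]] := cube_closed_subcover (@cube_closed_cylU _) sC.
(* r0 records the values of y at the coordinates where members of t differ
   from y, so that cyl r0 misses all of them *)
have [r0 [r0d [r0y r0s]]] : exists r, supported d r /\ cyl r y /\
    forall q, q \in t -> forall z, cyl r z -> ~ cyl q z.
  elim: t tP {tF} => [|q t IH] tP.
    by exists [::]; split=> // [?|]//; split=> //; apply/cylP.
  have [|r [r1 [r2 r3]]] := IH; first by move=> q' tq'; apply: tP; rewrite inE tq' orbT.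
  have [i [di ->]] := tP q (mem_head _ _); exists ((i, y i) :: r).
  split; first by move=> ib; rewrite inE => /predU1P[->//|]; exact: r1.
  split.
    by apply/cylP => ib; rewrite inE => /predU1P[->//|]; move/cylP: r2; apply.
  move=> q' ; rewrite inE => /predU1P[->|tq'] z /cylP h.
    move=> /cylP /(_ _ (mem_head _ _)) /=.
    by rewrite (h (i, y i)) ?mem_head//=; case: (y i).
  by apply: r3 => //; apply/cylP => ib rib; apply: h; rewrite inE rib orbT.
have Br : B r0.
  split=> //; exists s; split=> // z rz; apply: contrapT => ns.
  by have [q tq qz] := tF z ns; exact: (r0s q tq z rz qz).
have [_ /(_ y r0y) [p fp py]] := fP r0 Br.
by exists p => //; exists r0.
Qed.

End Cantor.

(** * A well-order of type omega_1 and codes for closed G_delta sets *)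

Notation binseq := (nat -> bool).

Lemma countable_preimage (S U : Type) (f : S -> U) (A : set U) :
  injective f -> countable A -> countable (f @^-1` A).
Proof.
move=> finj /countable_injP[g ginj]; apply/countable_injP; exists (g \o f).
by move=> x y /set_mem Ax /set_mem Ay /= e; apply/finj/ginj => //; apply/mem_set.
Qed.

(** If some element of a well-order of the continuum has uncountably many
    predecessors, let t be the least such element.  By CH the whole set injects
    into the initial segment below t, where initial segments are countable. *)
Lemma CH_order : continuum_hypothesis -> exists le : binseq -> binseq -> Prop,
  [/\ forall s t, le s t \/ le t s, forall r s t, le r s -> le s t -> le r t &
      forall t, countable [set s | le s t]].
Proof.
move=> [ucT minT]; have [R wR] := wochoice.well_ordering_principle binseq.
have minR (A : set binseq) x : A x -> exists2 z, A z & forall y, A y -> R z y.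
  move=> Ax; have [|z [[/asboolP zA zm] _]] := wR [pred x | `[< A x >]].
    by exists x; apply/asboolP.
  by exists z => // y Ay; apply: zm; apply/asboolP.
have totR s t : R s t \/ R t s.
  have [|z [->|->] h] := minR [set s; t] s; first by left.
    by left; apply: h; right.
  by right; apply: h; left.
have reflR s : R s s by have [] := totR s s.
have antiR s t : R s t -> R t s -> s = t.
  move=> st ts; have [|z [[zA zm] zu]] := wR [pred x | `[< x = s \/ x = t >]].
    by exists s; apply/asboolP; left.
  have <- : z = s.
    apply: zu; split=> /=; first by apply/asboolP; left.
    by move=> u /asboolP[->|->].
  apply: zu; split=> /=; first by apply/asboolP; right.
  by move=> u /asboolP[->|->].
have trR r s t : R r s -> R s t -> R r t.
  move=> rs st; have [|z zA h] := minR [set x | [\/ x = r, x = s | x = t]] r.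
    by constructor 1.
  case: zA h => -> h; first by apply: h; constructor 3.
    by rewrite (antiR r s) //; apply: h; constructor 1.
  by rewrite -(antiR s t) //; apply: h; constructor 2.
have [cR|/existsNP[t0 nc0]] := pselect (forall t, countable [set s | R s t]).
  by exists R; split.
have [t nct tm] := minR [set t | ~ countable [set s | R s t]] t0 nc0.
have ncB : ~ countable [set s | R s t /\ s <> t].
  move=> cB; apply: nct; rewrite (_ : [set s | _] =
    \bigcup_(b in [set: bool]) (if b then [set t] else [set s | R s t /\ s <> t])).
    by apply: bigcup_countable => // -[] _; first exact: countable1.
  rewrite predeqE => s; split=> [/= st|[[] _ /=]]; last 2 first.
  - by move=> ->.
  - by case.
  have [->|ne] := pselect (s = t); first by exists true.
  by exists false.
have /pcard_leP/injfunPex[f fB finj] := minT _ _ ncB.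
exists (fun s u => R (f s) (f u)); split=> [s u|r s u|u]; [exact: totR|exact: trR|].
apply: (@countable_preimage _ _ f [set s | R s (f u)]).
  by move=> x y; apply: finj; apply/mem_set.
apply: contrapT => /tm h; have [fu] := fB u Logic.I.
by apply; apply: antiR.
Qed.


Lemma binseq_seq_surj : exists dec : binseq -> nat -> binseq,
  forall u, exists t, dec t = u.
Proof.
exists (fun t n k => t (choice.pickle (n, k))) => u.
exists (fun m => if choice.unpickle m is Some nk then u nk.1 nk.2 else false).
by apply/funext => n; apply/funext => k; rewrite choice.pickleK.
Qed.

Lemma binseq_nat_surj : exists dec : binseq -> nat, forall n, exists t, dec t = n.
Proof.
exists (fun t => xget 0%N [set n | t = fun k => k == n]) => n.
exists (fun k => k == n); case: xgetP => [m _ /(congr1 (@^~ n))|/(_ n)]//=.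
by rewrite eqxx => /esym/eqP.
Qed.

Lemma binseq_pair_surj : exists dec : binseq -> binseq * nat,
  forall tn, exists t, dec t = tn.
Proof.
have [ds dsP] := binseq_seq_surj; have [dn dnP] := binseq_nat_surj.
exists (fun t => (ds t 0%N, dn (ds t 1%N))) => -[t n].
have [t' t'n] := dnP n; have [t'' e] := dsP (fun i => if i is 0 then t else t').
by exists t''; rewrite e t'n.
Qed.

(** Every closed G_delta set of the cube has a code in a set of size continuum:
    the conditions in a countable set are listed, and each of them is coded. *)
Lemma binseq_countable_sets_surj :
  exists g : binseq -> set (seq (binseq * bool)),
    (forall t, countable (g t)) /\ (forall Q, countable Q -> exists t, g t = Q).
Proof.
have [ds dsP] := binseq_seq_surj; have [dn dnP] := binseq_nat_surj.
(* slot 0 of the sequence codes the length plus one, or 0 for no condition *)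
have {dn dnP} [dc dcP] : exists dc : binseq -> option (seq (binseq * bool)),
    forall o, exists t, dc t = o.
  pose dp (t : binseq) := (fun k => t k.+1, t 0%N).
  exists (fun t => if dn (ds t 0%N) is n.+1 then
                   Some (mkseq (fun i => dp (ds t i.+1)) n) else None).
  case=> [p|]; last first.
    by have [t0 e0] := dnP 0%N; have [t e] := dsP (fun=> t0); exists t; rewrite e e0.
  have [t0 e0] := dnP (size p).+1.
  have [t e] := dsP (fun i => if i is j.+1 then
     fun k => if k is l.+1 then (nth (t0, false) p j).1 l
              else (nth (t0, false) p j).2 else t0).
  exists t; rewrite e e0; congr Some; rewrite -[RHS](mkseq_nth (t0, false)).
  by apply: eq_mkseq => i /=; rewrite /dp /=; case: (nth _ p i).
exists (fun t => [set p | exists n, dc (ds t n) = Some p]); split=> [t|Q cQ].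
  rewrite (_ : [set p | _] = \bigcup_(n in [set: nat]) [set p | dc (ds t n) = Some p]).
    apply: bigcup_countable => // n _; apply/countable_injP; exists (fun=> 0%N).
    by move=> p q /set_mem /= -> /set_mem /= [].
  by rewrite predeqE => p; split=> [[n np]|[n _ np]]; exists n.
have /countable_injP[f finj] := cQ.
have [n|e eP] := @boolp.choice nat binseq (fun n t => forall p, dc t = Some p <-> Q p /\ f p = n).
  have [[p [Qp fp]]|np] := pselect (exists p, Q p /\ f p = n); last first.
    by have [t tN] := dcP None; exists t => p; rewrite tN; split=> // h; case: np; exists p.
  have [t tp] := dcP (Some p); exists t => q; rewrite tp; split=> [[<-//]|[Qq fq]].
  by congr Some; apply: finj; rewrite ?fq//; apply/mem_set.
have [t te] := dsP e; exists t; rewrite predeqE => p; rewrite te; split=> [[n /eP[]]//|Qp].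
by exists (f p); apply/eP.
Qed.

(** * Adding isolated points to a subset of a Cantor cube *)

Section MichaelSpace.
Variables (J A : choiceType) (L : set (J -> bool)) (y : A -> J -> bool).

(** The additional coordinates indexed by A make the points y_a isolated, while
    a basic neighbourhood of a point of L excludes only finitely many of them
    through these coordinates. *)
Definition michael_emb (s : (set_type L + A)%type) : cube (J + A)%type := fun c =>
  match s, c with
  | inl l, inl j => val l j
  | inl _, inr _ => false
  | inr a, inl j => y a j
  | inr a, inr b => a == b
  end.

Definition michael_space : topologicalType := initial_topology michael_emb.

Lemma michael_regular : regular_space michael_space.
Proof. exact: (@uniform_regular (initial_topology michael_emb)). Qed.

Lemma michael_open_cyl p : open (michael_emb @^-1` cyl p : set michael_space).
Proof. by exists (cyl p) => //; exact: open_cyl. Qed.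

Lemma michael_open_nbhs (O : set michael_space) s : open O -> O s ->
  exists2 p, cyl p (michael_emb s) & michael_emb @^-1` cyl p `<=` O.
Proof.
move=> [V oV <-] Vs; have /nbhs_cyl[p ps pV] : nbhs (michael_emb s) V.
  exact: open_nbhs_nbhs.
by exists p => // s' ps'; apply: pV.
Qed.

Lemma michael_emb_inj : injective michael_emb.
Proof.
move=> [l|a] [l'|b] e; have {e} e c := congr1 (fun f => f c) e.
- congr inl; apply: val_inj; apply/funext => j; exact: (e (inl j)).
- by have := e (inr b); rewrite /= eqxx.
- by have := e (inr a); rewrite /= eqxx.
- by have := e (inr a); rewrite /= eqxx => /esym/eqP ->.
Qed.

Lemma michael_accessible : accessible_space michael_space.
Proof.
move=> s s' /eqP ss'.
have [c sc] : exists c, michael_emb s c <> michael_emb s' c.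
  apply/existsNP => e; apply: ss'; apply: michael_emb_inj; exact/funext.
exists (michael_emb @^-1` cyl [:: (c, michael_emb s c)]); split.
- exact: michael_open_cyl.
- by apply/mem_set; apply/cylP => ib; rewrite inE => /eqP ->.
- by apply/mem_set => /cylP /(_ _ (mem_head _ _)) /= e; apply: sc.
Qed.

Definition lpart (p : seq ((J + A) * bool)) : seq (J * bool) :=
  pmap (fun cb => if cb.1 is inl j then Some (j, cb.2) else None) p.
Definition rpart (p : seq ((J + A) * bool)) : seq A :=
  pmap (fun cb => if cb.1 is inr a then Some a else None) p.

Lemma lpartP p jb : (jb \in lpart p) = ((inl jb.1, jb.2) \in p).
Proof.
elim: p => [//|[[j|a] b] p IH]; rewrite /lpart /= !inE -/(lpart p) IH //=.
Qed.

Lemma rpartP p a b : (inr a, b) \in p -> a \in rpart p.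
Proof.
elim: p => [//|[[j|a'] b'] p IH]; rewrite /rpart /= !inE -/(rpart p).
  by move=> /predU1P[//|/IH].
by move=> /predU1P[[-> _]|/IH ->]; rewrite ?eqxx ?orbT.
Qed.

Lemma lpart_left p (l : set_type L) s : cyl p (michael_emb (inl l)) ->
  cyl (lpart p) (fun j => michael_emb s (inl j)) ->
  (forall a, s = inr a -> a \notin rpart p) -> cyl p (michael_emb s).
Proof.
move=> /cylP pl /cylP ps sr; apply/cylP => -[[j|a] b] /= pib.
  by have := ps (j, b); rewrite lpartP; apply.
have /= <- := pl _ pib; case: s ps sr => //= a' _ /(_ a' erefl) na'.
by apply/negP => /eqP e; move: na'; rewrite e (rpartP pib).
Qed.

(** An open set containing L contains, up to finitely many points for each
    basic set of a countable subcover of L, all the y_a that lie in the union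
    of this subcover; the hypothesis bounds the number of remaining y_a. *)
Lemma michael_lindelof : cylLindelof L ->
  (forall Q, countable Q -> L `<=` cylU Q -> countable [set a | ~ cylU Q (y a)]) ->
  lindelof michael_space.
Proof.
move=> LL conc; split; [exact: michael_regular|exact: michael_accessible|].
move=> C [oC CT].
have inC s : exists2 c, C c & c s by have : setT s by []; rewrite -CT.
pose R q (cw : set michael_space * seq A) := C cw.1 /\
  forall s, cyl q (fun j => michael_emb s (inl j)) ->
    (forall a, s = inr a -> a \notin cw.2) -> cw.1 s.
have [f fP] := @choice_in _ _ (set0, [::]) (fun q => exists cw, R q cw) R (fun _ h => h).
have LP : L `<=` cylU (fun q => exists cw, R q cw).
  move=> l Ll; pose s : michael_space := inl (SigSub (mem_set Ll)).
  have [c Cc cs] := inC s; have [p ps pc] := michael_open_nbhs (oC c Cc) cs.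
  exists (lpart p); last first.
    apply/cylP => jb; rewrite lpartP => pjb.
    by move/cylP: ps => /(_ _ pjb).
  by exists (c, rpart p); split=> // s' h1 h2; apply: pc; exact: lpart_left ps h1 h2.
have [Q [QP cQ LQ]] := LL _ LP.
have [h hP] := @boolp.choice _ _ (fun s c => C c /\ c s)
  (fun s => let: ex_intro2 c Cc cs := inC s in ex_intro _ c (conj Cc cs)).
pose B := [set a | ~ cylU Q (y a)] `|` \bigcup_(q in Q) [set` (f q).2].
exists ([set (f q).1 | q in Q] `|` [set h (inr a) | a in B]); split.
- by move=> c [[q /QP /fP[fC _] <-]|[a _ <-]] //; have [] := hP (inr a).
- apply: countableU; first exact: countable_image.
  apply: countable_image; apply: countableU; first exact: conc.
  by apply: bigcup_countable => // q _; exact: countable_seq.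
- rewrite predeqE => s; split=> // _.
  case: s => [l|a].
    have [q Qq ql] := LQ _ (set_valP l).
    exists (f q).1; first by left; exists q.
    by have [_] := fP q (QP q Qq); apply.
  have [Ba|nBa] := pselect (B a).
    by exists (h (inr a)); [right; exists a|have [] := hP (inr a)].
  have [q Qq qa] : cylU Q (y a) by apply: contrapT => h'; apply: nBa; left.
  exists (f q).1; first by left; exists q.
  have [_] := fP q (QP q Qq); apply=> // _ [<-].
  by apply/negP => aq; apply: nBa; right; exists q.
Qed.
End MichaelSpace.

(** * Separation of Lindelof sets *)

Section Separation.
Variables (X : topologicalType) (U : binseq -> set X).
Hypothesis oU : forall i, open (U i).
Hypothesis hX : productively_quasi_lindelof X.
Hypothesis uncT : ~ countable [set: binseq].
Variable le : binseq -> binseq -> Prop.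
Hypothesis le_total : forall s t, le s t \/ le t s.
Hypothesis le_countable : forall t, countable [set s | le s t].
Variable g : binseq -> set (seq (binseq * bool)).
Hypothesis gsurj : forall Q, countable Q -> exists t, g t = Q.

(** The complement consists of the y such that the U i with i in y cover X. *)
Definition noncovers : set (binseq -> bool) :=
  [set y | exists x, forall i, y i -> ~ U i x].

Lemma open_rect (Y : topologicalType) (A : set X) (B : set Y) :
  open A -> open B -> open (A `*` B : set (X * Y)).
Proof.
move=> oA oB; rewrite (_ : A `*` B = fst @^-1` A `&` snd @^-1` B) //.
apply: openI; apply: open_comp => // -[x y] _; [exact: cvg_fst|exact: cvg_snd].
Qed.

(** Otherwise choose, for each index t, a noncovering y t that belongs to all
    the open sets coded by an s below t and containing L.  Let x_t be a point
    of X witnessing that y t is noncovering.  In the product of X with the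
    space of L and the isolated points y t, the pairs (x_t, y t) form an
    uncountable set, and the cover below consists of open sets each of which
    contains at most one of these pairs. *)
Lemma Lindelof_separation L : cylLindelof L -> L `<=` ~` noncovers ->
  exists S, [/\ countable S, forall s, S s -> L `<=` cylU (g s) &
    forall y, noncovers y -> exists2 s, S s & ~ cylU (g s) y].
Proof.
move=> LL Lc; apply: contrapT => no.
have [t|y yP] := @boolp.choice _ _ (fun t y => noncovers y /\
   forall s, le s t -> L `<=` cylU (g s) -> cylU (g s) y).
  apply: contrapT => /forallNP noy; apply: no.
  exists [set s | le s t /\ L `<=` cylU (g s)]; split=> [|s []//|y uy].
    by apply: sub_countable (le_countable t); apply: subset_card_le => s [].
  have /not_andP[//|/existsNP[s /not_implyP[st /not_implyP[Ls ns]]]] := noy y.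
  by exists s.
have YL : lindelof (michael_space L y).
  apply: michael_lindelof => // Q /gsurj[s <-] Ls.
  apply: sub_countable (le_countable s); apply: subset_card_le => a /= na.
  by have [//|sa] := le_total a s; case: na; have [_] := yP a; apply.
pose C : set (set (X * michael_space L y)) :=
  [set U i `*` (@michael_emb _ _ L y @^-1` cyl [:: (inl i, true)]) | i in setT] `|`
  [set setT `*` (@michael_emb _ _ L y @^-1` cyl [:: (inr a, true)]) | a in setT].
have [|D [DC cD DT]] := hX YL (C := C).
  split=> [_ [[i _ <-]|[a _ <-]]|].
  - by apply: open_rect => //; exact: michael_open_cyl.
  - by apply: open_rect; [exact: openT|exact: michael_open_cyl].
  rewrite predeqE => -[x [l|a]]; split=> // _.
    have [i li Ux] : exists2 i, val l i & U i x.
      apply: contrapT => h; apply: (Lc _ (set_valP l)); exists x => i li Ui.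
      by apply: h; exists i.
    exists (U i `*` (@michael_emb _ _ L y @^-1` cyl [:: (inl i, true)])).
      by left; exists i.
    by split=> //; apply/cylP => ib; rewrite inE => /eqP ->.
  exists (setT `*` (@michael_emb _ _ L y @^-1` cyl [:: (inr a, true)])).
    by right; exists a.
  by split=> //; apply/cylP => ib; rewrite inE => /eqP ->; rewrite /= eqxx.
have [a|f fP] := @boolp.choice binseq (set (X * michael_space L y)) (fun a c => D c /\
   c = setT `*` (@michael_emb _ _ L y @^-1` cyl [:: (inr a, true)])).
  have [[x xP] _] := yP a.
  have : setT (x, inr a : michael_space L y) by []; rewrite -DT => -[c Dc /= cxa].
  exists c; split=> //; case: (DC c Dc) cxa => [[i _ <-]|[b _ <-]].
    move=> [/= Ui /cylP /(_ _ (mem_head _ _)) /= yi].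
    by case: (xP i).
  by move=> [_ /cylP /(_ _ (mem_head _ _)) /= /eqP <-].
apply: uncT; rewrite (_ : setT = f @^-1` D).
  apply: countable_preimage cD => a b ab.
  have [[x xP] _] := yP a.
  have : f b (x, inr a : michael_space L y).
    rewrite -ab (fP a).2; split=> //.
    by apply/cylP => ib; rewrite inE => /eqP ->; rewrite /= eqxx.
  by rewrite (fP b).2 => -[_ /cylP /(_ _ (mem_head _ _)) /= /eqP].
by rewrite predeqE => a; split=> // _; have [] := fP a.
Qed.
End Separation.

(** * Alster's theorem under CH *)

Section Alster.
Variable T : choiceType.
Implicit Types (p q : seq (T * bool)) (y z : T -> bool) (d : set T)
  (Q : set (seq (T * bool))).
Variable le : T -> T -> Prop.
Hypothesis le_total : forall s t, le s t \/ le t s.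
Hypothesis le_trans : forall r s t, le r s -> le s t -> le r t.
Hypothesis le_countable : forall t, countable [set s | le s t].
Variable g : T -> set (seq (T * bool)).
Hypothesis gc : forall t, countable (g t).
Variable N : set (T -> bool).
Hypothesis Ndown : forall y z, (forall i, z i -> y i) -> N y -> N z.
Hypothesis Nsep : forall L, cylLindelof L -> L `<=` ~` N ->
  exists S, [/\ countable S, forall s, S s -> L `<=` cylU (g s) &
    forall y, N y -> exists2 s, S s & ~ cylU (g s) y].

Definition restr d y : T -> bool := fun i => `[< d i >] && y i.

(** As N is downward closed, y is in [outside d] exactly when every point that
    agrees with y on d is outside N. *)
Definition outside d : set (T -> bool) := [set y | ~ N (restr d y)].

Lemma saturated_outside d : saturated d (outside d).
Proof.
move=> y z oy yz; rewrite /outside /= (_ : restr d z = restr d y) //.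
apply/funext => i; rewrite /restr; have [di|//] := asboolP (d i).
by rewrite yz.
Qed.

Lemma outside_mono d d' : d `<=` d' -> outside d `<=` outside d'.
Proof.
move=> dd' y; apply: contra_not; apply: Ndown => i /andP[/asboolP di yi].
by apply/andP; split=> //; apply/asboolP/dd'.
Qed.

Lemma outsideN d : outside d `<=` ~` N.
Proof. by move=> y; apply: contra_not; apply: Ndown => i /andP[]. Qed.

(** The code of the preimage under [restr d]: a condition can hold at [restr d
    y] only if it prescribes the value 0 outside d. *)
Definition restr_code d Q := [set p | exists2 r, Q r &
  p = [seq ib <- r | `[< d ib.1 >]] /\
  forall ib, ib \in r -> ~ d ib.1 -> ib.2 = false].

Lemma restr_codeP d Q y : cylU (restr_code d Q) y <-> cylU Q (restr d y).
Proof.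
split=> [[p [r Qr [-> rf]] /cylP py]|[r Qr /cylP ry]].
  exists r => //; apply/cylP => ib rib; rewrite /restr.
  have [di|ndi] := asboolP (d ib.1); last by rewrite (rf ib).
  by apply: py; rewrite mem_filter rib andbT; apply/asboolP.
exists [seq ib <- r | `[< d ib.1 >]].
  exists r => //; split=> // ib rib ndi; rewrite -(ry ib rib) /restr.
  by case: asboolP.
apply/cylP => ib; rewrite mem_filter => /andP[/asboolP di rib].
by rewrite -(ry ib rib) /restr; case: asboolP.
Qed.

Lemma restr_code_supported d Q p : restr_code d Q p -> supported d p.
Proof.
by move=> [r _ [-> _]] ib; rewrite mem_filter => /andP[/asboolP].
Qed.

Lemma countable_restr_code d Q : countable Q -> countable (restr_code d Q).
Proof.
move=> cQ; apply: sub_countable (countable_image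
  (fun r => [seq ib <- r | `[< d ib.1 >]]) cQ).
by apply: subset_card_le => _ [r Qr [-> _]]; exists r.
Qed.

(** [outside d] is Lindelof because only countably many coordinates matter, so
    it can be separated from N; the resulting codes are then restricted to d. *)
Lemma outside_Gdelta d : countable d -> exists S, countable S /\
  forall y, outside d y <-> forall s, S s -> cylU (restr_code d (g s)) y.
Proof.
move=> cd.
have [S [cS LS NS]] := Nsep (saturated_Lindelof cd (@saturated_outside d)) (@outsideN d).
exists S; split=> // y; split=> [oy s Ss|h].
  apply/restr_codeP; apply: LS Ss _ _; apply: saturated_outside oy _ => i di.
  by rewrite /restr; case: asboolP.
move=> /NS [s Ss]; apply; apply/restr_codeP; exact: h.
Qed.

(** A one-point set is Lindelof; the separating codes use countably many
    coordinates. *)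
Lemma outside_countable y : ~ N y -> exists2 d, countable d & outside d y.
Proof.
move=> nNy; have [P Py||S [cS LS NS]] := @Nsep [set y]; last 2 first.
- by move=> _ ->.
- have [s Ss|f fP] := choice_in [::] (D := S) (R := fun s p => g s p /\ cyl p y).
    by have [p gp py] := LS s Ss y erefl; exists p.
  exists (csupp (f @` S)); first exact/countable_csupp/countable_image.
  move=> /NS [s Ss]; apply; have [gf fy] := fP s Ss.
  exists (f s) => //; apply: (@eq_cyl _ (csupp (f @` S)) _ y) fy.
    by move=> ib fib; exists (f s); [exists s|exists ib].
  by move=> i di; rewrite /restr; case: asboolP.
have [p Pp py] := Py y erefl.
exists [set p]; split=> [_ ->//||_ ->]; first exact: countable1.
by exists p.
Qed.

Lemma supported_bigcup (d : nat -> set T) p :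
  (forall n m, (n <= m)%N -> d n `<=` d m) ->
  supported (\bigcup_n d n) p -> exists n, supported (d n) p.
Proof.
move=> dmono; elim: p => [|ib p IH] sp; first by exists 0%N.
have [|n np] := IH; first by move=> jb pjb; apply: sp; rewrite inE pjb orbT.
have [m _ dm] := sp ib (mem_head _ _).
exists (maxn n m) => jb; rewrite inE => /predU1P[->|/np].
  by apply: dmono dm; rewrite leq_maxr.
by apply: dmono; rewrite leq_maxl.
Qed.

(** Iterate omega times: add the values of f at the conditions supported so
    far, together with all their predecessors. *)
Lemma closing_off (f : seq (T * bool) -> set T) : (forall p, countable (f p)) ->
  exists d, [/\ countable d, forall s t, d t -> le s t -> d s &
    forall p, supported d p -> f p `<=` d].
Proof.
move=> cf.
pose e d := d `|` \bigcup_(t in \bigcup_(p in supported d) f p) [set s | le s t].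
pose d n := iter n e set0.
have dmono n m : (n <= m)%N -> d n `<=` d m.
  move=> /subnK <-; elim: (m - n)%N => [//|k IH] s /IH.
  by rewrite addSn; left.
have cd n : countable (d n).
  elim: n => [|n IH]; first exact: countable0.
  apply: countableU => //; apply: bigcup_countable => [|t _]; last exact: le_countable.
  by apply: bigcup_countable => // ; exact: countable_supported.
exists (\bigcup_n d n); split.
- exact: bigcup_countable.
- move=> s t [n _]; elim: n => [//|n IH] [/IH//|[u fu tu] st].
  by exists n.+1 => //; right; exists u => //; exact: le_trans st tu.
- move=> p /(supported_bigcup dmono)[n np] t fpt; exists n.+1 => //; right.
  by exists t; [exists p|have [] := le_total t t].
Qed.

Section Cover.
Variable h : T -> set (seq (T * bool)).
Hypothesis hc : forall t, countable (h t).
Hypothesis hK : forall K, cube_closed K -> K `<=` N -> exists t, K `<=` ~` cylU (h t).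

Let seg t := [set s | le s t].

(** Cutting down to the complement of [outside (seg t)] loses no point of N,
    but forces the pieces of large index to avoid [outside d] for a fixed
    initial segment d. *)
Let piece t := ~` cylU (h t) `\` outside (seg t).

Definition coverable (A : set (T -> bool)) :=
  exists2 S, countable S & A `<=` \bigcup_(t in S) piece t.

Lemma coverable_bigcup (J : Type) (D : set J) (A : J -> set (T -> bool)) :
  countable D -> (forall j, D j -> coverable (A j)) ->
  coverable (\bigcup_(j in D) A j).
Proof.
move=> cD cA.
have [j Dj|f fP] := choice_in set0 (D := D) (R := fun j S => countable S /\
    A j `<=` \bigcup_(t in S) piece t).
  by have [S cS SA] := cA j Dj; exists S.
exists (\bigcup_(j in D) f j).
  by apply: bigcup_countable => // j /fP[].
move=> z [j Dj Az]; have [_ /(_ z Az)[t ft tz]] := fP j Dj.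
by exists t => //; exists j.
Qed.

Lemma sub_coverable A B : A `<=` B -> coverable B -> coverable A.
Proof. by move=> AB [S cS BS]; exists S => // z /AB/BS. Qed.

Lemma sub_pieces : N `<=` \bigcup_t piece t.
Proof.
move=> y Ny; have [z zy||t ty] := @hK [set y].
- have [c yc] : exists c, y c <> z c.
    by apply/existsNP => e; apply: zy; apply/esym/funext.
  exists [:: (c, z c)]; first by apply/cylP => ib; rewrite inE => /eqP ->.
  by move=> _ /[swap] -> /cylP /(_ _ (mem_head _ _)).
- by move=> _ ->.
exists t => //; split; first exact: ty.
by move=> /outsideN.
Qed.

(** Let F be a counterexample and F' the set of the points of F at which F is
    not locally coverable.  Each of the closed sets C that constitute a piece
    is nowhere dense in F': if the part of F' in a basic set lay in C, then the
    part of F in this basic set would be covered by C and countably many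
    compact sets disjoint from F', hence be coverable.  Consequently no
    nonempty relatively open part of F' is contained in N: it would be a
    compact subset of N, contained in one piece.  Now let d be a sufficiently
    closed countable initial segment.  A point z of F' that is generic with
    respect to the coordinates in d is in [outside d] and in no piece with
    index in d; it is in no other piece either, as these avoid [outside d]. *)
Lemma coverable_closed F : cube_closed F -> F `<=` \bigcup_t piece t -> coverable F.
Proof.
move=> cF FG; apply: contrapT => ncF.
have [sg sgP] := @boolp.choice _ _ (fun t S => countable S /\ forall y,
    outside (seg t) y <-> forall s, S s -> cylU (restr_code (seg t) (g s)) y)
  (fun t => outside_Gdelta (le_countable t)).
pose R t s := h t `|` restr_code (seg t) (g s).
have RP t z : (forall s, sg t s -> cylU (R t s) z) -> ~ piece t z.
  move=> zR [nz]; apply; apply/(sgP t).2 => s /zR [r [hr|rr] rz]; last by exists r.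
  by case: nz; exists r.
have pieceR t s : sg t s -> ~` cylU (R t s) `<=` piece t.
  move=> sts z nz; split.
    by move=> [r hr rz]; apply: nz; exists r => //; left.
  move=> /(sgP t).2 /(_ s sts) [r hr rz]; apply: nz; exists r => //; right.
  exact: hr.
pose F' := [set z | F z /\ forall p, cyl p z -> ~ coverable (F `&` cyl p)].
have cF' : cube_closed F'.
  move=> z; have [Fz|/cF[p pz pF]] := pselect (F z); last first.
    by move=> _; exists p => // z' /pF nF [].
  move=> /not_andP[//|/existsNP[p /not_implyP[pz /contrapT cp]]].
  by exists p => // z' pz' [_ /(_ p pz')].
have local K : cube_closed K -> K `<=` F -> K `<=` ~` F' -> coverable K.
  move=> cK KF KF'.
  have KP : K `<=` cylU [set p | coverable (F `&` cyl p)].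
    move=> z Kz; have := KF' z Kz => /not_andP[/(_ (KF z Kz))//|].
    by move=> /existsNP[p /not_implyP[pz /contrapT cp]]; exists p.
  have [s [sP sK]] := cube_closed_subcover cK KP.
  apply: (@sub_coverable _ (\bigcup_(p in [set` s]) (F `&` cyl p))).
    by move=> z Kz; have [p ps pz] := sK z Kz; exists p => //; split=> //; exact: KF.
  by apply: coverable_bigcup; [exact: countable_seq|exact: sP].
(* the closed sets constituting a piece are nowhere dense in F' *)
have dense t s p : sg t s -> F' `&` cyl p !=set0 ->
    exists2 r, R t s r & F' `&` cyl (p ++ r) !=set0.
  move=> sts [z0 [[_ nc0] pz0]]; apply: contrapT => no.
  apply: (nc0 p pz0).
  apply: (@sub_coverable _ (piece t `|` \bigcup_(r in R t s) (F `&` cyl p `&` cyl r))).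
    move=> z [Fz pz]; have [[r rR rz]|nR] := pselect (cylU (R t s) z).
      by right; exists r.
    by left; exact: pieceR nR.
  rewrite -bigcup2E; apply: coverable_bigcup => // -[|[|n]] _ /=; last 1 first.
  - by exists set0.
  - by exists [set t]; [exact: countable1|move=> z tz; exists t].
  apply: coverable_bigcup.
    by apply: countableU => //; exact: countable_restr_code.
  move=> r rR; apply: local.
  - exact: cube_closedI (cube_closedI cF (@cube_closed_cyl _ p)) (@cube_closed_cyl _ r).
  - by move=> z [[]].
  - move=> z [[Fz pz] rz] F'z; apply: no; exists r => //; exists z.
    by rewrite cyl_cat.
have escape p : F' `&` cyl p !=set0 -> exists2 z, (F' `&` cyl p) z & ~ N z.
  move=> ne; apply: contrapT => no.
  have F'N : F' `&` cyl p `<=` N.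
    by move=> z Fz; apply: contrapT => nN; apply: no; exists z.
  have [t tP] := hK (cube_closedI cF' (@cube_closed_cyl _ p)) F'N.
  have step s q : sg t s -> True -> F' `&` cyl q !=set0 ->
      exists r, [/\ R t s r, True & F' `&` cyl (q ++ r) !=set0].
    by move=> sts _ /(dense t s q sts)[r r1 r2]; exists r.
  have [z [F'z pz zR]] := cube_closed_baire (sgP t).1 cF' step Logic.I ne.
  apply: (RP t z zR); split; first exact: tP.
  by move=> /outsideN; apply; exact: F'N.
have [p ne|gam gamP] := choice_in set0 (D := fun p => F' `&` cyl p !=set0)
    (R := fun p d => countable d /\ exists2 z, (F' `&` cyl p) z & outside d z).
  have [z Fz nN] := escape p ne; have [d cd od] := outside_countable nN.
  by exists d; split=> //; exists z.
(* d has to contain the coordinates showing that a part of F' is not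
   contained in N, and those used by the codes of index in d *)
pose f p := (if pselect (F' `&` cyl p !=set0) then gam p else set0) `|`
  \bigcup_(ib in [set` p]) csupp (h ib.1).
have cf p : countable (f p).
  apply: countableU.
    by case: pselect => // ne; have [] := gamP p ne.
  by apply: bigcup_countable => [|ib _]; [exact: countable_seq|exact: countable_csupp].
have [d [cd ddown dclosed]] := closing_off cf.
have [sd [csd sdP]] := outside_Gdelta cd.
pose D := [set Q | exists2 t, d t & exists2 s, sg t s & Q = R t s] `|`
  [set restr_code d (g s) | s in sd].
have cD : countable D.
  apply: countableU; last exact: countable_image.
  rewrite (_ : [set Q | _] = \bigcup_(t in d) [set R t s | s in sg t]).
    by apply: bigcup_countable => // t _; apply: countable_image; have [] := sgP t.
  rewrite predeqE => Q; split=> [[t dt [s ts ->]]|[t dt [s ts <-]]].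
    by exists t => //; exists s.
  by exists t => //; exists s.
have step Q p : D Q -> supported d p -> F' `&` cyl p !=set0 ->
    exists r, [/\ Q r, supported d (p ++ r) & F' `&` cyl (p ++ r) !=set0].
  move=> [[t dt [s ts ->]]|[s sds <-]] sp ne.
    have [r Rr ner] := dense t s p ts ne; exists r; split=> //.
    apply: supported_cat => //; case: Rr => [hr ib rib|/restr_code_supported sr ib /sr].
      have : supported d [:: (t, true)] by move=> jb; rewrite inE => /eqP ->.
      move=> /dclosed; apply; right; exists (t, true); first exact: mem_head.
      by exists r => //; exists ib.
    exact: ddown.
  have [_ [z [F'z pz] gz]] := gamP p ne.
  have /sdP /(_ s sds)[r rr rz] : outside d z.
    apply: outside_mono gz => t gt; apply: (dclosed p sp); left.
    by case: pselect.
  exists r; split=> //; last by exists z; rewrite cyl_cat.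
  by apply: supported_cat => //; exact: restr_code_supported rr.
have ne : F' `&` cyl [::] !=set0.
  apply: contrapT => no; apply: ncF; apply: local => // z Fz F'z.
  by apply: no; exists z; split=> //; apply/cylP.
have s0 : supported d [::] by [].
have [z [[Fz _] _ zD]] := cube_closed_baire cD cF' step s0 ne.
have [t _ tz] := FG z Fz.
have [dt|ndt] := pselect (d t).
  by apply: (RP t z) tz => s ts; apply: zD; left; exists t => //; exists s.
case: tz => _; apply; apply: (@outside_mono d); last first.
  by apply/sdP => s sds; apply: zD; right; exists s.
move=> s ds; have [//|ts] := le_total s t.
by case: ndt; exact: ddown ts.
Qed.

(** The set L of the points in no piece is Lindelof: the complement of an open
    set containing L is compact and covered by countably many pieces, and the
    complement of these pieces depends on countably many coordinates.
    Separating N from L gives countably many compact sets contained in the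
    union of all pieces. *)
Theorem countable_subcover_of_codes : exists2 S, countable S &
  forall y, N y -> exists2 t, S t & ~ cylU (h t) y.
Proof.
pose L := [set z | forall t, ~ piece t z].
have LL : cylLindelof L.
  move=> P LP.
  have [||S cS SP] := @coverable_closed (~` cylU P); first exact: cube_closed_cylU.
    move=> z nz; apply: contrapT => no; apply: nz; apply: LP => t tz.
    by apply: no; exists t.
  pose d := \bigcup_(t in S) (csupp (h t) `|` seg t).
  pose L' := [set z | forall t, S t -> ~ piece t z].
  have cd : countable d.
    apply: bigcup_countable => // t _; apply: countableU; last exact: le_countable.
    exact: countable_csupp.
  have sL' : saturated d L'.
    move=> y z L'y yz t St [nz oz]; apply: (L'y t St); split.
      move=> [p hp py]; apply: nz; exists p => //; apply: (@eq_cyl _ d _ y) py => [ib pib|i di].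
        by exists t => //; left; exists p => //; exists ib.
      exact: yz.
    move=> oy; apply: oz; apply: saturated_outside oy _ => i ti.
    by apply: yz; exists t => //; right.
  have [|Q [QP cQ LQ]] := saturated_Lindelof cd sL' (P := P).
    by move=> z L'z; apply: contrapT => /SP[t St tz]; exact: (L'z t St).
  by exists Q; split=> // z Lz; apply: LQ => t _; exact: Lz.
have [|S [cS LS NS]] := Nsep LL.
  by move=> z Lz /sub_pieces[t _ tz]; exact: (Lz t).
have [|S' cS' SS'] := @coverable_bigcup _ S (fun s => ~` cylU (g s)) cS.
  move=> s Ss; apply: coverable_closed; first exact: cube_closed_cylU.
  move=> z nz; apply: contrapT => no; apply: nz; apply: LS Ss _ _ => t tz.
  by apply: no; exists t.
exists S' => // y Ny; have [s Ss sy] := NS y Ny.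
by have [|t S't [ty _]] := SS' y; [exists s|exists t].
Qed.

End Cover.
End Alster.

(** * Countable powers *)

Definition alster_property (T : choiceType) (N : set (T -> bool)) :=
  forall GG : set (set (seq (T * bool))), (forall Q, GG Q -> countable Q) ->
    (forall K, cube_closed K -> K `<=` N -> exists2 Q, GG Q & K `<=` ~` cylU Q) ->
  exists D, [/\ D `<=` GG, countable D &
    forall y, N y -> exists2 Q, D Q & ~ cylU Q y].

Section Power.
Variables (T : choiceType) (N : set (T -> bool)).
Implicit Types (y : nat -> T -> bool) (s : seq (nat * T)) (w : seq (set (T -> bool))).
Hypothesis Ndown : forall (y z : T -> bool), (forall i, z i -> y i) -> N y -> N z.
Hypothesis AL : alster_property N.
Variable SS : set (seq (nat * T)).

(** When y i consists of the t with z i outside U t, this says that z lies in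
    the box with factor U t in coordinate i for each pair (i, t) in s. *)
Definition misses y s := forall it, it \in s -> y it.1 it.2 = false.

Hypothesis SScover : forall y, (forall i, N (y i)) -> exists2 s, SS s & misses y s.

(** The list w is a position K_0, ..., K_(n-1) of a game in which compact
    subsets of N are chosen successively.  It is good when the part of N^omega
    over some product of closed G_delta sets containing the K_i is covered by
    countably many boxes of SS. *)
Definition good w := exists (q : nat -> set (seq (T * bool))) (S' : set (seq (nat * T))),
  [/\ forall i, countable (q i),
      forall i, (i < size w)%N -> nth set0 w i `<=` ~` cylU (q i),
      S' `<=` SS, countable S' &
      forall y, (forall i, N (y i)) ->
        (forall i, (i < size w)%N -> ~ cylU (q i) (y i)) ->
        exists2 s, S' s & misses y s].

(** If all one-step extensions are good, Alster's property yields countably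
    many codes Q whose closed G_delta sets cover N, each with closed G_delta
    sets containing the earlier K_i.  For each i the intersection of the latter
    is again a closed G_delta set, so the position itself is good. *)
Lemma bad_extends w : ~ good w ->
  exists K, [/\ cube_closed K, K `<=` N & ~ good (rcons w K)].
Proof.
move=> bad; apply: contrapT => no.
have gK K : cube_closed K -> K `<=` N -> good (rcons w K).
  by move=> cK KN; apply: contrapT => bK; apply: no; exists K.
pose V Q (qS : (nat -> set (seq (T * bool))) * set (seq (nat * T))) :=
  [/\ forall i, countable (qS.1 i),
      forall i, (i < size w)%N -> nth set0 w i `<=` ~` cylU (qS.1 i),
      qS.2 `<=` SS, countable qS.2 &
      forall y, (forall i, N (y i)) ->
        (forall i, (i < size w)%N -> ~ cylU (qS.1 i) (y i)) ->
        ~ cylU Q (y (size w)) -> exists2 s, qS.2 s & misses y s].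
have [||D [DG cD DN]] := AL (GG := [set Q | countable Q /\ exists qS, V Q qS]).
- by move=> Q [].
- move=> K cK KN; have [q [S' [cq wq SS' cS' qP]]] := gK K cK KN.
  exists (q (size w)); last first.
    by have := wq (size w); rewrite size_rcons nth_rcons ltnn eqxx; apply.
  split=> //; exists (q, S'); split=> // [i iw|y Ny yq yw].
    have := wq i; rewrite size_rcons nth_rcons iw; apply.
    by rewrite ltnS ltnW.
  apply: qP => // i; rewrite size_rcons ltnS leq_eqVlt => /predU1P[->//|].
  exact: yq.
have [Q DQ|f fP] := choice_in (fun=> set0, set0) (D := D) (R := V).
  by have [_ []] := DG Q DQ => qS; exists qS.
apply: bad; exists (fun i => \bigcup_(Q in D) (f Q).1 i), (\bigcup_(Q in D) (f Q).2).
split.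
- by move=> i; apply: bigcup_countable => // Q /fP[].
- move=> i iw z wz [p [Q DQ fp] pz]; have [_ wq _ _ _] := fP Q DQ.
  by apply: (wq i iw z wz); exists p.
- by move=> s [Q DQ fs]; have [_ _ h _ _] := fP Q DQ; exact: h.
- by apply: bigcup_countable => // Q /fP[].
move=> y Ny yq; have [Q DQ nQ] := DN _ (Ny (size w)).
have [_ _ _ _ h] := fP Q DQ; have [||//|s fs ms] := h y.
- by [].
- by move=> i iw [p fp pz]; apply: (yq i iw); exists p => //; exists Q.
- by exists s => //; exists Q.
Qed.

Definition box s : seq ((nat * T) * bool) :=
  [seq (it, false) | it <- s].

(** Starting from a bad empty position, all positions of a play are bad.  On
    the other hand finitely many boxes cover the compact product of the chosen
    sets.  They involve finitely many coordinates i < n and finitely many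
    indices in Lam, and the points of the cube that agree on Lam with a point
    of K_i form a clopen set containing K_i; so the n-th position is good. *)
Lemma countable_power_subcover : exists S', [/\ S' `<=` SS, countable S' &
  forall y, (forall i, N (y i)) -> exists2 s, S' s & misses y s].
Proof.
apply: contrapT => no.
have [y0 Ny0] : exists y0 : T -> bool, N y0.
  apply: contrapT => nN; apply: no; exists set0; split=> //.
  by move=> y /(_ 0%N) Ny; case: nN; exists (y 0%N).
pose z0 : T -> bool := fun=> false.
have Nz0 : N z0 by apply: Ndown Ny0.
have [w bw|f fP] := choice_in set0 (D := fun w => ~ good w)
  (R := fun w K => [/\ cube_closed K, K `<=` N & ~ good (rcons w K)]).
  exact: bad_extends.
pose W n := iter n (fun w => rcons w (f w)) [::].
have bW n : ~ good (W n).
  elim: n => [|n /fP[_ _]//]; move=> [q [S' [_ _ SS' cS' h]]]; apply: no.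
  by exists S'; split=> // y Ny; apply: h.
pose K n := f (W n).
have WK n : W n = mkseq K n by elim: n => [//|n IH]; rewrite mkseqS -IH.
have cK n : cube_closed (K n) by have [] := fP _ (bW n).
have KN n : K n `<=` N by have [] := fP _ (bW n).
(* the zero point is added to fill in the coordinates beyond n with a point of
   the i-th factor, even if K i is empty *)
pose F : set (nat * T -> bool) :=
  [set u | forall i, (K i `|` [set z0]) (fun t => u (i, t))].
have cF : cube_closed F.
  move=> u /existsNP[i /not_orP[nK /eqP nz]].
  have [p pu pK] := cK i _ nK.
  have [t ut] : exists t, u (i, t) = true.
    apply: contrapT => h; move/eqP: nz; apply; apply/funext => t.
    by apply: contrapT => /eqP; case ut: (u (i, t)) => // _; apply: h; exists t.
  exists (((i, t), true) :: [seq ((i, ib.1), ib.2) | ib <- p]).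
    apply/cylP => jb; rewrite inE => /predU1P[->//|/mapP[ib pib ->]].
    by move/cylP: pu => /(_ ib pib).
  move=> u' /cylP h /(_ i) [|/(congr1 (@^~ t))].
    apply: pK; apply/cylP => ib pib.
    by rewrite (h ((i, ib.1), ib.2)) // inE; apply/orP; right; apply: map_f.
  by rewrite (h ((i, t), true)) ?mem_head.
have FP : F `<=` cylU (box @` SS).
  move=> u Fu; have [i|s sS ms] := @SScover (fun i t => u (i, t)).
    by have [/KN|->] := Fu i.
  exists (box s); first by exists s.
  by apply/cylP => ib /mapP[[i t] /ms h ->].
have [pl [plS plF]] := cube_closed_subcover cF FP.
have [p pp|e eP] := choice_in [::] (D := [set` pl]) (R := fun p s => SS s /\ box s = p).
  by have [s sS <-] := plS p pp; exists s.
pose Lam := [seq ib.1.2 | ib <- flatten pl].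
pose n := (\max_(ib <- flatten pl) ib.1.1).+1.
pose q i := [set p | supported [set` Lam] p /\ K i `&` cyl p = set0].
apply: (bW n); exists q, (e @` [set` pl]); split.
- move=> i; apply: (@sub_countable _ _ _ [set p | supported [set` Lam] p]).
    by apply: subset_card_le => p [].
  by apply: countable_supported; exact: countable_seq.
- move=> i; rewrite WK size_mkseq => i_n; rewrite nth_mkseq // => z Kz [p [_ Kp] pz].
  by have : (K i `&` cyl p) z by []; rewrite Kp.
- by move=> _ [p /eP[] ? _ <-].
- by apply: countable_image; exact: countable_seq.
move=> y Ny; rewrite WK size_mkseq => yq.
have [i i_n|k kP] := choice_in z0 (D := fun i => (i < n)%N)
    (R := fun i z => K i z /\ forall t, t \in Lam -> y i t = z t).
  have : ~ q i [seq (t, y i t) | t <- Lam].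
    move=> qi; apply: (yq i i_n); exists [seq (t, y i t) | t <- Lam] => //.
    by apply/cylP => ib /mapP[t _ ->].
  move=> /not_andP[[]|/eqP/set0P[z [Kz /cylP zy]]].
    by move=> ib /mapP[t tL ->].
  by exists z; split=> // t tL; rewrite (zy (t, y i t)) //; exact: map_f.
pose u (it : nat * T) := if (it.1 < n)%N then k it.1 it.2 else false.
have uE i : (fun t => u (i, t)) = if (i < n)%N then k i else z0.
  by apply/funext => t; rewrite /u [(i, t).1]/=; case: ifP.
have [i|p pp /cylP pu] := plF u.
  rewrite uE; case: ifPn => i_n; last by right.
  by left; have [] := kP i i_n.
have [sS bs] := eP p pp; exists (e p); first by exists p.
move=> [i t] its.
have ip : ((i, t), false) \in p by rewrite -[X in _ \in X]bs; exact: map_f.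
have ipl : ((i, t), false) \in flatten pl by apply/flattenP; exists p.
have i_n : (i < n)%N.
  by rewrite ltnS; exact: (@leq_bigmax_seq _ _ predT (fun ib : (nat * T) * bool => ib.1.1) _ ipl).
have [_ ->] := kP i i_n; last by apply/mapP; exists ((i, t), false).
by have := pu _ ip; rewrite -[u _]/((fun t => u (i, t)) t) uE i_n.
Qed.

End Power.

(** * Reduction to continuum many open sets *)

(** The pair (b, m) of a code b of a box of the subcover and a number m indexes
    the m-th open factor of this box. *)
Lemma continuum_coded_boxes (X : topologicalType) (C : set (set {ptws nat -> X})) :
  subcovers_of_size_le {ptws nat -> X} continuum -> open_cover C ->
  exists U : binseq -> set X, (forall t, open (U t)) /\
    forall x : nat -> X, exists2 s : seq (nat * binseq),
      (exists2 c, C c & forall z : nat -> X,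
         (forall it, it \in s -> U it.2 (z it.1)) -> c z) &
      forall it, it \in s -> U it.2 (x it.1).
Proof.
move=> lX [oC CT].
pose bx (l : seq (nat * set X)) : set {ptws nat -> X} :=
  [set z | forall io, io \in l -> io.2 (z io.1)].
pose opens (l : seq (nat * set X)) := forall io, io \in l -> open io.2.
have [|D [DB cD DT]] := lX [set B | exists l, [/\ opens l, B = bx l &
     exists2 c, C c & B `<=` c]].
  split=> [_ [l [ol -> _]]|]; first exact: ptws_open_box.
  rewrite predeqE => x; split=> // _.
  have : setT x by []; rewrite -CT => -[c Cc cx].
  have [l [l1 l2]] := ptws_nbhs_box (open_nbhs_nbhs (conj (oC c Cc) cx)).
  exists (bx l); last by move=> io /l1[].
  by exists l; split=> // [io /l1[]//|]; exists c.
have [f finj] : exists f : set {ptws nat -> X} -> binseq, {in D &, injective f}.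
  exact/pcard_injP.
have [b|e eP] := @boolp.choice _ _ (fun b l => opens l /\
    forall B, D B -> f B = b -> B = bx l).
  have [[B [Db fB]]|no] := pselect (exists B, D B /\ f B = b); last first.
    by exists [::]; split=> // B Db fB; case: no; exists B.
  have [l [ol Bl _]] := DB B Db; exists l; split=> // B' Db' fB'.
  by rewrite -Bl; apply: finj; rewrite ?fB'//; exact/mem_set.
have [dp dpP] := binseq_pair_surj.
have [en enK] := boolp.choice dpP.
exists (fun t => nth setT (map snd (e (dp t).1)) (dp t).2); split=> [t|x].
  have [m_lt|m_ge] := ltnP (dp t).2 (size (map snd (e (dp t).1))).
    have /mapP[io eio ->] := mem_nth setT m_lt.
    by have [oe _] := eP (dp t).1; exact: oe.
  by rewrite nth_default //; exact: openT.
have : setT (x : {ptws nat -> X}) by []; rewrite -DT => -[B DBB /= Bx].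
have [_ /(_ B DBB erefl) Be] := eP (f B).
have [_ [_ _ [c Cc Bc]]] := DB B DBB.
pose b := f B; rewrite -/b in Be.
pose s := [seq ((nth (0%N, setT) (e b) m).1, en (b, m)) | m <- iota 0 (size (e b))].
have sP (z : nat -> X) : (forall it, it \in s ->
    nth setT (map snd (e (dp it.2).1)) (dp it.2).2 (z it.1)) <-> bx (e b) z.
  split=> [h io /(nthP (0%N, setT))[m m_lt <-]|h it /mapP[m]].
    have := h ((nth (0%N, setT) (e b) m).1, en (b, m)).
    rewrite /= enK /= (nth_map (0%N, setT)) //; apply.
    by apply/mapP; exists m; rewrite ?mem_iota.
  rewrite mem_iota add0n => /andP[_ m_lt] ->.
  by rewrite /= enK /= (nth_map (0%N, setT)) //; apply: h; exact: mem_nth.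
exists s; first by exists c => // z /sP; rewrite -Be => /Bc.
by apply/sP; rewrite -Be.
Qed.

Unset Implicit Arguments.

Theorem corollary7p3 (CH : continuum_hypothesis)
  (X : topologicalType) (hX : productively_quasi_lindelof X)
  (T : Type) (ell : set T)
  (hell : is_lindelof_number {ptws nat -> X} ell)
  (hle : ell #<= continuum) :
  powerfully_quasi_lindelof X.
Proof.
have lX : subcovers_of_size_le {ptws nat -> X} continuum.
  move=> C /hell.1[D [DC cD DT]]; exists D; split=> //.
  exact: card_le_trans cD hle.
move=> C oC; have [U [oU UP]] := continuum_coded_boxes lX oC.
have [le [le_total le_trans le_c]] := CH_order CH.
have [g [gc gsurj]] := binseq_countable_sets_surj.
pose N := noncovers U.
have Ndown (y z : binseq -> bool) : (forall i, z i -> y i) -> N y -> N z.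
  by move=> zy [x xy]; exists x => i /zy /xy.
have Nsep := Lindelof_separation oU hX CH.1 le_total le_c gsurj.
have AL : alster_property N.
  move=> GG GGc GK.
  have [||Q0 GQ0 _] := GK set0; [by move=> z _; exists [::] => // ? _ []|by []|].
  pose h t := if pselect (GG (g t)) then g t else Q0.
  have hG t : GG (h t) by rewrite /h; case: pselect.
  have [K cK KN|S cS SN] := countable_subcover_of_codes le_total le_trans le_c gc
      Ndown Nsep (fun t => GGc _ (hG t)).
    have [Q GQ KQ] := GK K cK KN; have [t tQ] := gsurj Q (GGc Q GQ).
    by exists t; rewrite /h tQ; case: pselect.
  exists (h @` S); split.
  - by move=> _ [t _ <-].
  - exact: countable_image.
  - by move=> y /SN[t St ty]; exists (h t) => //; exists t.
pose SS := [set s : seq (nat * binseq) | exists2 c, C c & forall z : nat -> X,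
   (forall it, it \in s -> U it.2 (z it.1)) -> c z].
have [y yN|S [SSS cS SN]] := countable_power_subcover Ndown AL (SS := SS).
  have [x xP] := boolp.choice yN.
  have [s sS sx] := UP x; exists s => // it its.
  apply/negbTE/negP => yit; exact: (xP it.1 it.2 yit (sx it its)).
have [s Ss|c cP] := choice_in set0 (D := S) (R := fun s c => C c /\
    forall z : nat -> X, (forall it, it \in s -> U it.2 (z it.1)) -> c z).
  by have [c Cc sc] := SSS s Ss; exists c.
exists (c @` S); split.
- by move=> _ [s /cP[Cc _] <-].
- exact: countable_image.
rewrite predeqE => z; split=> // _.
have [i|s Ss ms] := SN (fun i t => ~~ `[< U t (z i) >]).
  by exists (z i) => t /asboolPn.
exists (c s); first by exists s.
have [_] := cP s Ss; apply=> it its.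
by apply: contrapT => /asboolPn; rewrite (ms it its).
Qed.
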